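(* Let $d=3$, $n=1$, $G_H=\begin{pmatrix} 1 & 1 \\ 1 & -1 \end{pmatrix}$ over $\mathbb Z_3$, and for $0\le p\le1$ let $|\psi_p\rangle=\sqrt p\,|0\rangle+\sqrt{1-p}\,|1\rangle\in\mathbb C^3$ and $\sigma_p=|\psi_p\rangle\langle\psi_p|$. Let $\Lambda_{\sigma_p}$ be the quantum convolutional channel with convolution matrix $G_H$ and environment $\sigma_p$. Then for every $0\le p\le 1$, $$\chi(\Lambda_{\sigma_p})=\log3-h_2(p)=\log3-\min_{\mathcal M}S(\Delta_{\mathcal M}(\sigma_p)),$$ where the minimum is over all maximal isotropic subspaces $\mathcal M\subseteq\mathbb Z_3\times\mathbb Z_3$.
   Context: All logarithms are base two. $S(\rho)=-\operatorname{tr}\rho\log\rho$ is the von Neumann entropy and $h_2(p)=-p\log p-(1-p)\log(1-p)$ the binary entropy. Weyl operators on $\mathbb C^3$: $\omega_3=e^{2\pi i/3}$, $X|k\rangle=|k+1\rangle$, $Z|k\rangle=\omega_3^k|k\rangle$ (arithmetic mod $3$), $w(p,q)=\omega_3^{-2^{-1}pq}Z^pX^q$ for $(p,q)\in\mathbb Z_3\times\mathbb Z_3$, with $2^{-1}$ the inverse of $2$ in $\mathbb Z_3$. Symplectic form: $\langle(p,q),(p',q')\rangle_s=pq'-p'q$. A maximal isotropic subspace $\mathcal M\subseteq\mathbb Z_3\times\mathbb Z_3$ is a one-dimensional linear subspace (on which the form vanishes), and $\Delta_{\mathcal M}(\rho)=\frac13\sum_{u\in\mathcal M}w(u)\rho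 w(u)^\dagger$. Convolutional channel. For $G=\begin{pmatrix} g_{00} & g_{01} \\ g_{10} & g_{11} \end{pmatrix}$ invertible over $\mathbb Z_3$ and $N_G=(\det G)^{-1}$, $U_G$ is the unitary on $\mathbb C^3_A\otimes\mathbb C^3_B$ with $U_G|i,j\rangle=|N_Gg_{11}i-N_Gg_{10}j,\,-N_Gg_{01}i+N_Gg_{00}j\rangle$, $i,j\in\mathbb Z_3$, and $\Lambda_\sigma(\rho)=\operatorname{tr}_B[U_G(\rho\otimes\sigma)U_G^\dagger]$. The one-shot Holevo information of a channel $\Lambda$ is $\chi(\Lambda)=\max_{\{p_i,\rho_i\}}\big[S(\Lambda(\sum_ip_i\rho_i))-\sum_ip_iS(\Lambda(\rho_i))\big]$, over finite ensembles of input states. *)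

(* Defs.v *)
From HB Require Import structures.
From mathcomp Require Import all_boot all_order all_algebra.
From mathcomp Require Import complex mxtens.
From mathcomp Require Import all_classical all_reals.
From mathcomp Require Import exp trigo.

Set Implicit Arguments.
Unset Strict Implicit.
Unset Printing Implicit Defensive.

Import Order.TTheory GRing.Theory Num.Theory.
Local Open Scope classical_set_scope.
Local Open Scope ring_scope.
Local Open Scope sesquilinear_scope.
Local Open Scope complex_scope.

Definition is_max (R : realType) (A : set R) (x : R) : Prop :=
  A x /\ ubound A x.

Definition is_min (R : realType) (A : set R) (x : R) : Prop :=
  A x /\ lbound A x.

Definition log2 (R : realType) (x : R) : R := ln x / ln 2.

(* [ln 0 = 0] in the library, which gives the convention 0 log 0 = 0 here and
   in [vn_entropy]. *)
Definition h2 (R : realType) (p : R) : R :=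
  - (p * log2 p) - (1 - p) * log2 (1 - p).

(* Functional calculus: [A = P^t* *m diag_mx d *m P] with [P] unitary whenever
   [A] is normal, and [d] is real when [A] is Hermitian. *)
Definition mxlog2 (R : realType) n (A : 'M[R[i]]_n) : 'M[R[i]]_n :=
  (spectralmx A)^t*
    *m diag_mx (map_mx (fun x => (log2 (complex.Re x))%:C) (spectral_diag A))
    *m spectralmx A.

(* The trace is real on states; [Re] only brings it from R[i] to R. *)
Definition vn_entropy (R : realType) n (rho : 'M[R[i]]_n) : R :=
  complex.Re (- \tr (rho *m mxlog2 rho)).

Definition is_density (R : realType) n (rho : 'M[R[i]]_n) : Prop :=
  [/\ rho \is hermsymmx,
      forall v : 'cV[R[i]]_n, 0 <= (v^t* *m rho *m v) 0 0
    & \tr rho = 1].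

(* Computational basis vectors are indexed by 'I_3, which is convertible to
   'F_3, so that arithmetic on labels is arithmetic mod 3. *)
Definition ket (R : realType) (k : 'F_3) : 'cV[R[i]]_3 := delta_mx k 0.
Arguments ket : clear implicits.

Definition ket2 (R : realType) (i j : 'F_3) : 'cV[R[i]]_(3 * 3) :=
  delta_mx (@mxtens_index 3 3 (i, j)) 0.
Arguments ket2 : clear implicits.

Definition omega3 (R : realType) : R[i] :=
  cos (2 * pi / 3) +i* sin (2 * pi / 3).
Arguments omega3 : clear implicits.

Definition weylX (R : realType) : 'M[R[i]]_3 :=
  \sum_(k : 'F_3) ket R (k + 1) *m (ket R k)^t*.
Arguments weylX : clear implicits.

(* Exponents of [omega3] and of [weylZ], [weylX] are residues mod 3, used
   through their representatives in {0, 1, 2}; all three have order 3. *)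
Definition weylZ (R : realType) : 'M[R[i]]_3 :=
  \sum_(k : 'F_3) omega3 R ^+ k *: (ket R k *m (ket R k)^t*).
Arguments weylZ : clear implicits.

(* [^o] equips 'F_3 with its vector space structure over itself. *)
Notation phase_space := (('F_3)^o * ('F_3)^o)%type.

Definition weyl (R : realType) (u : phase_space) : 'M[R[i]]_3 :=
  let e : 'F_3 := - (2%:R^-1 * u.1 * u.2) in
  omega3 R ^+ e *: (weylZ R ^+ (u.1 : 'F_3) *m weylX R ^+ (u.2 : 'F_3)).
Arguments weyl : clear implicits.

Definition symp_form (u v : phase_space) : 'F_3 := u.1 * v.2 - v.1 * u.2.

Definition isotropic (M : {vspace phase_space}) : Prop :=
  forall u v, u \in M -> v \in M -> symp_form u v = 0.

Definition maximal_isotropic (M : {vspace phase_space}) : Prop :=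
  isotropic M /\ (\dim M = 1)%N.

Definition dephasing (R : realType) (M : {vspace phase_space})
    (rho : 'M[R[i]]_3) : 'M[R[i]]_3 :=
  3%:R^-1 *: \sum_(u : phase_space | u \in M) weyl R u *m rho *m (weyl R u)^t*.

Definition dephased_entropies (R : realType) (rho : 'M[R[i]]_3) : set R :=
  [set vn_entropy (dephasing M rho) | M in maximal_isotropic].

Definition min_dephased_entropy (R : realType) (rho : 'M[R[i]]_3) : R :=
  inf (dephased_entropies rho).

Definition mx22 (T : nzRingType) (a b c d : T) : 'M[T]_2 :=
  \matrix_(i < 2, j < 2) nth 0 (nth [::] [:: [:: a; b]; [:: c; d]] i) j.

Definition conv_unitary (R : realType) (G : 'M['F_3]_2) : 'M[R[i]]_(3 * 3) :=
  let N := (\det G)^-1 in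
  \sum_(i : 'F_3) \sum_(j : 'F_3)
    ket2 R (N * G 1 1 * i - N * G 1 0 * j) (- N * G 0 1 * i + N * G 0 0 * j)
      *m (ket2 R i j)^t*.
Arguments conv_unitary : clear implicits.

Definition ptrace2 (R : realType) m n (A : 'M[R[i]]_(m * n)) : 'M[R[i]]_m :=
  \matrix_(i, j) \sum_(k < n) A (mxtens_index (i, k)) (mxtens_index (j, k)).

Definition conv_channel (R : realType) (G : 'M['F_3]_2)
    (sigma rho : 'M[R[i]]_3) : 'M[R[i]]_3 :=
  ptrace2 (conv_unitary R G *m (rho *t sigma) *m (conv_unitary R G)^t*).

Definition is_ensemble (R : realType) n k
    (q : 'I_k -> R) (rho : 'I_k -> 'M[R[i]]_n) : Prop :=
  [/\ forall i, 0 <= q i, \sum_i q i = 1 & forall i, is_density (rho i)].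

Definition holevo_quantity (R : realType) m n
    (L : 'M[R[i]]_m -> 'M[R[i]]_n) k
    (q : 'I_k -> R) (rho : 'I_k -> 'M[R[i]]_m) : R :=
  vn_entropy (L (\sum_i (q i)%:C *: rho i))
    - \sum_i q i * vn_entropy (L (rho i)).

Definition holevo_quantities (R : realType) m n
    (L : 'M[R[i]]_m -> 'M[R[i]]_n) : set R :=
  [set x | exists k (q : 'I_k -> R) (rho : 'I_k -> 'M[R[i]]_m),
     is_ensemble q rho /\ x = holevo_quantity L q rho].

Definition holevo_information (R : realType) m n
    (L : 'M[R[i]]_m -> 'M[R[i]]_n) : R :=
  sup (holevo_quantities L).

Definition GH : 'M['F_3]_2 := mx22 1 1 1 (-1).

Definition psi (R : realType) (p : R) : 'cV[R[i]]_3 :=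
  (Num.sqrt p)%:C *: ket R 0 + (Num.sqrt (1 - p))%:C *: ket R 1.

Definition sigma (R : realType) (p : R) : 'M[R[i]]_3 := psi p *m (psi p)^t*.

(* Main.v *)
Require Import Defs.
From mathcomp Require Import all_boot all_order all_algebra.
From mathcomp Require Import complex all_classical all_reals exp.
From mathcomp Require Import mxtens trigo ring lra.

Import Order.TTheory GRing.Theory Num.Theory.
Local Open Scope ring_scope.
Local Open Scope sesquilinear_scope.
Local Open Scope complex_scope.

(* A qutrit state whose purity is at most [p^2 + (1 - p)^2] has entropy at least
   [h2 p]: this is an inequality between the three eigenvalues. Both the outputs
   of the channel and the dephased states satisfy the purity bound. For the
   channel,
     [Lambda(rho)_ij = sum_k rho_(i+k)(j+k) sigma_(i-k)(j-k)],
   so, with [S = sum_i rho_ii^2] and [c = p (1 - p)],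
     [tr Lambda(rho)^2 = (1 - 2 c) S + c (1 - S) + c (tr rho^2 - S)
                      <= (1 - 2 c) S + 2 c (1 - S) <= 1 - 2 c]
   as [c <= 1/4]. Hence every output has entropy at least [h2 p], with equality
   on the basis states, whose uniform mixture is sent to the maximally mixed
   state. A dephased state is either [diag(p, 1 - p, 0)] (for the line spanned by
   [Z]) or has purity [(1 + 2 c) / 3 <= 1 - 2 c]. *)

(** * Entropy of three-point distributions *)

Lemma ln_le_sub1 (R : realType) (x : R) : 0 < x -> ln x <= x - 1.
Proof. by move=> x0; rewrite -{1}(subrKC 1 x) le_ln1Dx//; lra. Qed.

(** Pointwise form of Gibbs' inequality, from [ln t <= t - 1] at [t = s / x]: summed over two
    distributions, the terms [x - s] cancel. *)
Lemma mul_ln_ge_tangent (R : realType) (x s : R) : 0 <= x -> 0 < s ->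
  x * ln s + (x - s) <= x * ln x.
Proof.
rewrite le_eqVlt => /orP[/eqP <-|x0] s0; first by lra.
have : ln (s / x) <= s / x - 1 by apply: ln_le_sub1; rewrite divr_gt0.
rewrite ln_div// => /(ler_wpM2l (ltW x0)).
rewrite !mulrBr mulr1 mulrCA divff ?gt_eqF// mulr1; lra.
Qed.

(** The same logarithm bound at [t = x / s]; the correction [x * (x / s - 1)] will measure the gain
    from splitting a weight [s] into parts. *)
Lemma mul_ln_le_quadratic (R : realType) (x s : R) : 0 <= x -> 0 < s ->
  x * ln x <= x * ln s + x * (x / s - 1).
Proof.
rewrite le_eqVlt => /orP[/eqP <-|x0] s0; first by rewrite !mul0r addr0.
have : ln (x / s) <= x / s - 1 by apply: ln_le_sub1; rewrite divr_gt0.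
rewrite ln_div// => /(ler_wpM2l (ltW x0)); rewrite mulrBr; lra.
Qed.

(** Gibbs' inequality against the uniform distribution. *)
Lemma entropy3_le_ln3 (R : realType) (x y z : R) :
  0 <= x -> 0 <= y -> 0 <= z -> x + y + z = 1 ->
  - (x * ln x) - y * ln y - z * ln z <= ln 3.
Proof.
move=> x0 y0 z0 s1; have t0 : 0 < 3^-1 :> R by rewrite invr_gt0 ltr0n.
have := mul_ln_ge_tangent _ x _ x0 t0; have := mul_ln_ge_tangent _ y _ y0 t0.
have := mul_ln_ge_tangent _ z _ z0 t0; rewrite lnV ?posrE ?ltr0n//.
have e : (x + y + z) * ln 3 = ln 3 by rewrite s1 mul1r.
by move: e; rewrite !mulrN !mulrDl; lra.
Qed.

Lemma entropy3_ge_of_half_le (R : realType) (p x y z : R) :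
  1 / 2 <= p <= 1 -> 1 / 2 <= x -> 0 <= y -> 0 <= z -> x + y + z = 1 ->
  x ^+ 2 + y ^+ 2 + z ^+ 2 <= p ^+ 2 + (1 - p) ^+ 2 ->
  - (p * ln p) - (1 - p) * ln (1 - p) <= - (x * ln x) - y * ln y - z * ln z.
Proof.
move=> /andP[p2 p1] x2 y0 z0 s1 ic.
have [x1|x1] := leP 1 x.
  have [-> -> ->] : [/\ y = 0, z = 0 & x = 1] by split; lra.
  have -> : p = 1 by nra.
  by rewrite subrr !mul0r; lra.
have s0 : 0 < 1 - x by lra.
set s := 1 - x in s0.
have p0 : 0 <= p by lra.
have q0 : 0 <= 1 - p by lra.
have x0 : 0 < x by lra.
(* Gibbs' inequality compares the entropy of (p, 1 - p) with that of (x, s); the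
   second-order bounds on y ln y and z ln z show that splitting s into y and z
   gains at least 2 y z / s. *)
have := mul_ln_ge_tangent _ p _ p0 x0; have := mul_ln_ge_tangent _ (1 - p) _ q0 s0.
have := mul_ln_le_quadratic _ y _ y0 s0; have := mul_ln_le_quadratic _ z _ z0 s0.
have Dge : ln s <= ln x by rewrite ler_ln ?posrE// /s; lra.
have : ln (x / s) <= x / s - 1 by apply: ln_le_sub1; rewrite divr_gt0.
rewrite ln_div ?posrE// => Dle.
(* The left-hand side is the most by which Gibbs' inequality lets the entropy of [(p, 1 - p)] exceed
   that of [(x, s)]; the gain from splitting [s] has to cover it. *)
have key : (x - p) * (ln x - ln s) <= 2 * y * z / s.
  have yz0 : 0 <= 2 * y * z / s by apply: divr_ge0 (ltW s0); rewrite !mulr_ge0.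
  have [xp|px] := leP x p.
    by apply: le_trans yz0; rewrite mulr_le0_ge0 ?subr_le0 ?subr_ge0.
  have xp0 : 0 <= x - p by lra.
  apply: le_trans (ler_wpM2l xp0 Dle) _.
  rewrite ler_pdivlMr//.
  have -> : (x - p) * (x / s - 1) * s = (x - p) * (x - s) by field; rewrite gt_eqF.
  (* The purity bound reads [2 (x - p) (x + p - 1) <= 2 y z], and [x - s = 2 x - 1 <= 2 (x + p - 1)]
     because [p >= 1 / 2]. *)
  rewrite /s; nra.
have yzE : y * (y / s - 1) + z * (z / s - 1) = - (2 * y * z / s).
  have -> : z = s - y by rewrite /s; lra.
  by field; rewrite gt_eqF.
move: yzE key; have -> : y = s - z by rewrite /s; lra.
have -> : x = 1 - s by rewrite /s; lra.
move: (ln p) (ln (1 - s)) (ln s) (ln (1 - p)) (ln z) (ln (s - z)) (2 * _ * z / s).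
move=> a b c d e f g; nra.
Qed.

Lemma entropy3_ge (R : realType) (p x y z : R) :
  0 <= p <= 1 -> 0 <= x -> 0 <= y -> 0 <= z -> x + y + z = 1 ->
  x ^+ 2 + y ^+ 2 + z ^+ 2 <= p ^+ 2 + (1 - p) ^+ 2 ->
  - (p * ln p) - (1 - p) * ln (1 - p) <= - (x * ln x) - y * ln y - z * ln z.
Proof.
(* Both sides of the claim are compatible with [p -> 1 - p]. The first slash only separates [p] from
   the assumption [1 / 2 <= p]. *)
wlog p2 : p / 1 / 2 <= p => [wh|].
  move=> p01 x0 y0 z0 s1 ic; have [|p2] := leP (1 / 2) p; first by move/wh; exact.
  have := wh (1 - p); rewrite subKr => H.
  by rewrite addrC [_ - p * _]addrC addrC; apply: le_trans (H _ _ _ _ _ _ _) _ => //; lra.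
move=> /andP[p0 p1] x0 y0 z0 s1 ic.
have p21 : 1 / 2 <= p <= 1 by rewrite p2.
(* If x, y, z < 1 / 2, then - ln x, - ln y, - ln z >= ln 2 >= - p ln p - (1 - p) ln (1 - p). *)
have [x2|x2] := leP (1 / 2) x; first exact: entropy3_ge_of_half_le.
have [y2|y2] := leP (1 / 2) y.
  have /= := entropy3_ge_of_half_le _ p y x z p21 y2 x0 z0 ltac:(lra) ltac:(lra).
  lra.
have [z2|z2] := leP (1 / 2) z.
  have /= := entropy3_ge_of_half_le _ p z y x p21 z2 y0 x0 ltac:(lra) ltac:(lra).
  lra.
have h0 : 0 < 2^-1 :> R by rewrite invr_gt0 ltr0n.
have lnh (t : R) : 0 <= t -> t < 1 / 2 -> t * ln t <= t * ln 2^-1.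
  rewrite le_eqVlt => /orP[/eqP <-|t0] t2; first by rewrite !mul0r.
  by rewrite ler_wpM2l ?(ltW t0)// ler_ln ?posrE//; lra.
have := lnh x x0 x2; have := lnh y y0 y2; have := lnh z z0 z2.
have := mul_ln_ge_tangent _ p _ p0 h0.
have := mul_ln_ge_tangent _ (1 - p) _ ltac:(lra) h0.
have : (x + y + z) * ln 2^-1 = ln 2^-1 by rewrite s1 mul1r.
rewrite !mulrDl; lra.
Qed.

(** * Spectrum and entropy of a density matrix *)

Lemma char_poly_conj (K : fieldType) n (P D : 'M[K]_n) : P \in unitmx ->
  char_poly (invmx P *m D *m P) = char_poly D.
Proof.
move=> Pu; pose C := map_mx (@polyC K).
have -> : char_poly (invmx P *m D *m P) = \det (C _ _ (invmx P) *m char_poly_mx D *m C _ _ P).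
  congr (\det _); rewrite /char_poly_mx mulmxBr mulmxBl -!map_mxM; congr (_ - _).
  by rewrite mul_mx_scalar -scalemxAl -map_mxM mulVmx// map_mx1 scalemx1.
by rewrite !det_mulmx mulrAC -det_mulmx -map_mxM mulVmx// map_mx1 det1 mul1r.
Qed.

(** Collects all that is needed about one list of real eigenvalues, so that entropy and purity
    bounds become statements about real numbers. The characteristic polynomial determines the list
    up to order. *)
Lemma hermitian_spectrum (R : realType) n (A : 'M[R[i]]_n) :
  A \is hermsymmx -> exists d : 'I_n -> R,
  [/\ vn_entropy A = - \sum_i d i * log2 (d i),
      \tr A = (\sum_i d i)%:C,
      \tr (A *m A) = (\sum_i d i ^+ 2)%:C,
      char_poly A = \prod_i ('X - (d i)%:C%:P)
    & (forall v : 'cV[R[i]]_n, 0 <= (v^t* *m A *m v) 0 0) ->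
      forall i, 0 <= d i].
Proof.
move=> hA; pose P := spectralmx A; pose D := spectral_diag A.
have Pu : P \in unitmx := spectral_unit A.
have PV : P^t* = invmx P by rewrite invmx_unitary ?spectral_unitarymx.
have AE : A = invmx P *m diag_mx D *m P.
  exact: (orthomx_spectralP (hermitian_normalmx hA)).
have Dreal i : (complex.Re (D 0 i))%:C = D 0 i.
  by apply: RRe_real; exact: (mxOverP (hermitian_spectral_diag_real hA)).
have mulD (B C : 'M[R[i]]_n) :
    (invmx P *m B *m P) *m (invmx P *m C *m P) = invmx P *m (B *m C) *m P.
  by rewrite !mulmxA mulmxK.
have trD (B : 'M[R[i]]_n) : \tr (invmx P *m B *m P) = \tr B.
  by rewrite mxtrace_mulC mulmxA mulmxV// mul1mx.
exists (fun i => complex.Re (D 0 i)); split.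
- rewrite /vn_entropy /mxlog2 -/P -/D PV {1}AE mulD trD mulmx_diag mxtrace_diag.
  rewrite raddfN raddf_sum /=; congr (- _); apply: eq_bigr => i _.
  by rewrite !mxE -{1}Dreal -rmorphM.
- rewrite AE trD mxtrace_diag rmorph_sum; apply: eq_bigr => i _.
  by rewrite /= Dreal.
- rewrite AE mulD trD mulmx_diag mxtrace_diag rmorph_sum; apply: eq_bigr => i _.
  by rewrite !mxE /= rmorphXn /= Dreal expr2.
- rewrite AE char_poly_conj// char_poly_trig ?diag_mx_is_trig//.
  by apply: eq_bigr => i _; rewrite Dreal mxE eqxx mulr1n.
(* At the [i]-th eigenvector the quadratic form takes the value [d i]. *)
- move=> A0 i; have := A0 (P^t* *m delta_mx i 0).
  rewrite trmx_mul map_mxM /= trmxCK PV AE !mulmxA mulmxK// mulmxK//.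
  have -> : (delta_mx i 0 : 'cV[R[i]]_n)^t* = delta_mx 0 i by rewrite trmx_delta map_delta_mx.
  by rewrite -rowE -colE !mxE eqxx mulr1n -Dreal ler0c.
Qed.

(** The unitary chosen by [spectralmx] need not be the identity on a diagonal matrix. Two
    factorizations of the characteristic polynomial show that the spectrum is a permutation of the
    diagonal, and the entropy sum is symmetric. *)
Lemma vn_entropy_diag (R : realType) n (e : 'rV[R]_n) :
  vn_entropy (diag_mx (map_mx (fun x => x%:C) e)) = - \sum_i e 0 i * log2 (e 0 i).
Proof.
set A := diag_mx _.
have hA : A \is hermsymmx.
  apply/is_hermitianmxP; rewrite expr0 scale1r tr_diag_mx map_diag_mx.
  by congr diag_mx; apply/matrixP => i j; rewrite !mxE; exact/esym/conjc_real.
have [d [-> _ _ cp _]] := hermitian_spectrum _ _ _ hA; congr (- _).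
have : char_poly A = \prod_i ('X - (e 0 i)%:C%:P).
  rewrite char_poly_trig ?diag_mx_is_trig//; apply: eq_bigr => i _.
  by rewrite !mxE eqxx mulr1n.
rewrite cp => E.
have /prod_XsubC_eq pe : \prod_(x <- [seq (d i)%:C | i <- index_enum 'I_n]) ('X - x%:P) =
    \prod_(x <- [seq (e 0 i)%:C | i <- index_enum 'I_n]) ('X - x%:P).
  by rewrite !big_map.
pose g (x : R[i]) := complex.Re x * log2 (complex.Re x).
have -> : \sum_i d i * log2 (d i) = \sum_(x <- [seq (d i)%:C | i <- index_enum 'I_n]) g x.
  by rewrite big_map.
by rewrite (perm_big _ pe) big_map.
Qed.

Lemma vn_entropy_le_log3 (R : realType) (rho : 'M[R[i]]_3) :
  is_density rho -> vn_entropy rho <= log2 3.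
Proof.
move=> [/hermitian_spectrum[d [-> tr _ _ d0]] /d0 {}d0].
rewrite tr => -[]; rewrite !big_ord_recl !big_ord0 => s1.
rewrite /log2 !mulrA !addr0 -!mulrDl -mulNr.
rewrite ler_pM2r ?invr_gt0 ?ln_gt0 ?ltr1n//.
have := entropy3_le_ln3 _ _ _ _ (d0 ord0) (d0 (lift ord0 ord0))
  (d0 (lift ord0 (lift ord0 ord0))) ltac:(lra).
by lra.
Qed.

Lemma vn_entropy_ge_h2 (R : realType) (p : R) (rho : 'M[R[i]]_3) :
  0 <= p <= 1 -> is_density rho ->
  \tr (rho *m rho) <= (p ^+ 2 + (1 - p) ^+ 2)%:C -> h2 p <= vn_entropy rho.
Proof.
move=> p01 [/hermitian_spectrum[d [-> tr -> _ d0]] /d0 {}d0].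
rewrite tr lecR => -[]; rewrite !big_ord_recl !big_ord0 => s1 ic.
rewrite /h2 /log2 !mulrA !addr0 -!mulrDl -[in leRHS]mulNr -mulNr -mulrBl.
rewrite ler_pM2r ?invr_gt0 ?ln_gt0 ?ltr1n//.
have := entropy3_ge _ _ _ _ _ p01 (d0 ord0) (d0 (lift ord0 ord0))
  (d0 (lift ord0 (lift ord0 ord0))) ltac:(lra) ltac:(lra).
by lra.
Qed.

(** * The channel *)

Lemma F3_ind (P : 'F_3 -> Prop) : P 0 -> P 1 -> P 2%:R -> forall x, P x.
Proof.
move=> P0 P1 P2 x; have : x \in [:: 0; 1; 2%:R : 'F_3] by case: x => [[|[|[|//]]]].
by rewrite !inE => /or3P[] /eqP ->.
Qed.

Lemma sum_F3 (V : nmodType) (F : 'F_3 -> V) : \sum_(k : 'F_3) F k = F 0 + F 1 + F 2%:R.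
Proof.
rewrite !big_ord_recl big_ord0 /= addr0 addrA; congr (F _ + F _ + F _); exact: val_inj.
Qed.

Lemma conv_unitary_GH (R : realType) : conv_unitary R GH =
  \sum_i \sum_j ket2 R (- i - j) (j - i) *m (ket2 R i j)^t*.
Proof.
have [E00 E01 E10 E11] : [/\ GH 0 0 = 1, GH 0 1 = 1, GH 1 0 = 1 & GH 1 1 = -1].
  by split; rewrite mxE.
rewrite /conv_unitary.
(* The determinant is [-2], which is [1] mod 3. *)
have -> : \det GH = 1.
  rewrite (expand_det_row _ 0) !big_ord_recl big_ord0 /cofactor !det_mx11 !mxE /=.
  exact/eqP.
rewrite E00 E01 E10 E11 invr1.
apply: eq_bigr => i _; apply: eq_bigr => j _.
by rewrite !mulr1 !mul1r !mulN1r [- i + j]addrC.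
Qed.

(** The unitary permutes the basis, and [(a, b) -> (a + b, a - b)] inverts
    [(i, j) -> (- i - j, j - i)] because [-2 = 1] mod 3. *)
Lemma row_conv_unitary_GH (R : realType) (a b : 'F_3) :
  (ket2 R a b)^t* *m conv_unitary R GH = (ket2 R (a + b) (a - b))^t*.
Proof.
have adj i j : (ket2 R i j)^t* = delta_mx 0 (@mxtens_index 3 3 (i, j)).
  by rewrite trmx_delta map_delta_mx.
rewrite conv_unitary_GH mulmx_sumr (bigD1 (a + b)) //= mulmx_sumr (bigD1 (a - b)) //=.
have nz i j : (i, j) != (a + b, a - b) ->
    (ket2 R a b)^t* *m (ket2 R (- i - j) (j - i) *m (ket2 R i j)^t*) = 0.
  move=> ne; rewrite !adj mul_delta_mx mul_delta_mx_cond.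
  rewrite (can_eq (@mxtens_indexK 3 3)) mulrb ifF//.
  apply: contra_neqF ne => /eqP[-> ->]; congr (_, _).
    by elim/F3_ind: i; elim/F3_ind: j; apply/eqP.
  by elim/F3_ind: i; elim/F3_ind: j; apply/eqP.
rewrite [X in _ + X + _]big1 ?addr0 => [|j jn]; last first.
  by rewrite nz// xpair_eqE negb_and jn orbT.
rewrite big1 ?addr0 => [|i i_n]; last first.
  by rewrite mulmx_sumr big1// => j _; rewrite nz// xpair_eqE negb_and i_n.
rewrite !adj mul_delta_mx mul_delta_mx_cond.
rewrite (can_eq (@mxtens_indexK 3 3)) mulrb ifT// xpair_eqE.
by elim/F3_ind: a {nz}; elim/F3_ind: b.
Qed.

Lemma conv_channel_GHE (R : realType) (s rho : 'M[R[i]]_3) (i j : 'F_3) :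
  conv_channel GH s rho i j = \sum_(k : 'F_3) rho (i + k) (j + k) * s (i - k) (j - k).
Proof.
rewrite /conv_channel mxE; apply: eq_bigr => k _.
set U := conv_unitary R GH; set T := rho *t s.
have -> : (U *m T *m U^t*) (@mxtens_index 3 3 (i, k)) (@mxtens_index 3 3 (j, k)) =
   ((ket2 R i k)^t* *m (U *m T *m U^t*) *m ket2 R j k) 0 0.
  by rewrite trmx_delta map_delta_mx -rowE -colE !mxE.
rewrite !mulmxA row_conv_unitary_GH -mulmxA.
have -> : U^t* *m ket2 R j k = ket2 R (j + k) (j - k).
  by rewrite -[LHS]trmxCK trmx_mul map_mxM /= trmxCK row_conv_unitary_GH trmxCK.
rewrite trmx_delta map_delta_mx -rowE -colE !mxE.
by rewrite !mxtens_indexK.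
Qed.

(** * Density matrices entrywise *)

Lemma hermsymmxP (R : realType) n (A : 'M[R[i]]_n) :
  reflect (forall i j, A i j = Num.conj (A j i)) (A \is hermsymmx).
Proof.
apply: (iffP (is_hermitianmxP _ _ _)); rewrite expr0 scale1r.
  by move=> AE i j; rewrite {1}AE !mxE.
by move=> AE; apply/matrixP => i j; rewrite !mxE.
Qed.

Lemma quadratic_formE (R : realType) n (A : 'M[R[i]]_n) (v : 'cV[R[i]]_n) :
  (v^t* *m A *m v) 0 0 = \sum_i \sum_j Num.conj (v i 0) * A i j * v j 0.
Proof.
rewrite -mulmxA mxE; apply: eq_bigr => i _; rewrite !mxE mulr_sumr.
by apply: eq_bigr => j _; rewrite mulrA.
Qed.

Lemma density_diag (R : realType) n (rho : 'M[R[i]]_n) : is_density rho ->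
  exists r : 'I_n -> R, forall i, 0 <= r i /\ rho i i = (r i)%:C.
Proof.
move=> [_ pos _]; exists (fun i => complex.Re (rho i i)) => i.
have : 0 <= rho i i.
  have := pos (delta_mx i 0).
  by rewrite trmx_delta map_delta_mx -rowE -colE !mxE.
move=> r0; rewrite RRe_real ?ger0_real//; split=> //.
by move: r0; rewrite lecE => /andP[].
Qed.

(** The eigenvalues are nonnegative with sum 1, so each is at most 1 and dominates its square. *)
Lemma density_purity_le1 (R : realType) n (rho : 'M[R[i]]_n) : is_density rho ->
  \tr (rho *m rho) <= 1.
Proof.
move=> [/hermitian_spectrum[d [_ tr -> _ d0]] /d0 {}d0]; rewrite tr => -[s1].
rewrite -[1]/(1%:C) lecR -s1; apply: ler_sum => i _.
rewrite -[leRHS]mulr1 -[in leRHS]s1 expr2 ler_wpM2l// (bigD1 i)//= lerDl.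
by apply: sumr_ge0.
Qed.

Definition psi_amp (R : realType) (p : R) (k : 'F_3) : R :=
  if k == 0 then Num.sqrt p else if k == 1 then Num.sqrt (1 - p) else 0.

Lemma sigmaE (R : realType) (p : R) (i j : 'F_3) :
  sigma p i j = (psi_amp R p i)%:C * (psi_amp R p j)%:C.
Proof.
have psiE k : psi p k 0 = (psi_amp R p k)%:C.
  rewrite !mxE /psi_amp eqxx !andbT; elim/F3_ind: k => /=.
  - by rewrite mulr1 mulr0 addr0.
  - by rewrite mulr1 mulr0 add0r.
  - by rewrite !mulr0 addr0.
rewrite mxE big_ord1 [X in _ * X]mxE [X in _ * _ X]mxE !psiE; congr (_ * _).
exact: conjc_real.
Qed.

Lemma conv_channel_density (R : realType) (p : R) (rho : 'M[R[i]]_3) :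
  0 <= p <= 1 -> is_density rho -> is_density (conv_channel GH (sigma p) rho).
Proof.
move=> /andP[p0 p1] [/hermsymmxP herm pos tr].
have conj_amp k : Num.conj ((psi_amp R p k)%:C) = (psi_amp R p k)%:C by exact: conjc_real.
split.
- apply/hermsymmxP => i j; rewrite !conv_channel_GHE rmorph_sum.
  apply: eq_bigr => k _; rewrite !sigmaE !rmorphM /= !conj_amp -herm; congr (_ * _).
  exact: mulrC.
- move=> v; rewrite quadratic_formE.
  (* As [sigma p] is pure with real amplitudes, each traced-out label [k] contributes one Kraus
     operator. [w k] is its adjoint applied to [v], in the shifted label [l = i + k], where
     [i - k = l - k - k]. *)
  pose w (k : 'F_3) : 'cV[R[i]]_3 :=
    \matrix_(l, _) ((psi_amp R p ((l : 'F_3) - k - k))%:C * v ((l : 'F_3) - k) 0).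
  suff -> : \sum_i \sum_j Num.conj (v i 0) * conv_channel GH (sigma p) rho i j * v j 0 =
      \sum_(k : 'F_3) ((w k)^t* *m rho *m w k) 0 0 by apply: sumr_ge0.
  transitivity (\sum_(k : 'F_3) \sum_i \sum_j Num.conj (v i 0) *
     (rho (i + k) (j + k) * sigma p (i - k) (j - k)) * v j 0).
    rewrite [RHS]exchange_big; apply: eq_bigr => i _ /=; rewrite [RHS]exchange_big.
    by apply: eq_bigr => j _; rewrite conv_channel_GHE mulr_sumr mulr_suml.
  apply: eq_bigr => k _; rewrite quadratic_formE [RHS](reindex_inj (addIr k)).
  apply: eq_bigr => i _ /=; rewrite [RHS](reindex_inj (addIr k)).
  apply: eq_bigr => j _ /=; rewrite sigmaE !mxE !addrK rmorphM /= conj_amp.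
  ring.
- rewrite -tr /mxtrace.
  transitivity (\sum_(i : 'F_3) conv_channel GH (sigma p) rho i i) => //.
  under eq_bigr do rewrite conv_channel_GHE.
  (* The shift works because [- k = k + k] mod 3. Afterwards [rho] no longer involves [k], and the
     double sum factors into two traces. *)
  have F k : \sum_(i : 'F_3) rho (i + k) (i + k) * sigma p (i - k) (i - k) = 
     \sum_(i : 'F_3) rho i i * sigma p (i + k) (i + k).
    rewrite [RHS](reindex_inj (addIr k)); apply: eq_bigr => i _.
    by congr (_ * sigma p _ _); elim/F3_ind: k; elim/F3_ind: i; apply/eqP.
  rewrite exchange_big /=; under eq_bigr do rewrite F.
  rewrite exchange_big /=; apply: eq_bigr => i _; rewrite -mulr_sumr.
  have -> : \sum_(k : 'F_3) sigma p (i + k) (i + k) = \sum_(k : 'F_3) sigma p k k.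
    by rewrite [RHS](reindex_inj (addrI i)).
  rewrite sum_F3 !sigmaE /psi_amp /=.
  rewrite mulr0 addr0 -!rmorphM -!expr2 !sqr_sqrtr ?subr_ge0// -rmorphD /=.
  by rewrite addrC subrK mulr1.
Qed.

(** * Purity of the channel outputs *)

Lemma F3_addE : ((1 + 1 = 2%:R :> 'F_3) * (1 + 2%:R = 0 :> 'F_3) * (2%:R + 1 = 0 :> 'F_3) *
  (2%:R + 2%:R = 1 :> 'F_3) * (- 1 = 2%:R :> 'F_3) * (- 2%:R = 1 :> 'F_3)).
Proof. by do !split; apply/eqP. Qed.

Definition F3E := (F3_addE, addr0, add0r, oppr0).

Lemma psi_ampE (R : realType) (p : R) :
  (psi_amp R p 0 = Num.sqrt p) * (psi_amp R p 1 = Num.sqrt (1 - p)) *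
  (psi_amp R p 2%:R = 0).
Proof. by []. Qed.

Lemma mxtrace_sqr_F3 (R : realType) (A : 'M[R[i]]_3) :
  \tr (A *m A) = \sum_(i : 'F_3) \sum_(j : 'F_3) A i j * A j i.
Proof. by apply: eq_bigr => i _; rewrite mxE. Qed.

Lemma mxtrace_F3 (R : realType) (A : 'M[R[i]]_3) : \tr A = \sum_(i : 'F_3) A i i.
Proof. by []. Qed.

Lemma sqrtr_complex (R : realType) (x : R) :
  0 <= x -> x%:C = (Num.sqrt x)%:C * (Num.sqrt x)%:C.
Proof. by move=> x0; rewrite -rmorphM -expr2 sqr_sqrtr. Qed.

(** In a diagonal output entry two weights of [rho] meet, with coefficients [p] and [1 - p]; the
    cross terms give [\tr rho ^+ 2 - S]. In an off-diagonal output entry only one [k] survives, and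
    these entries together meet each off-diagonal entry of [rho] once, giving
    [\tr (rho *m rho) - S]. *)
Lemma conv_channel_purityE (R : realType) (p : R) (rho : 'M[R[i]]_3) :
  0 <= p <= 1 ->
  let S := \sum_(i : 'F_3) rho i i ^+ 2 in
  \tr (conv_channel GH (sigma p) rho *m conv_channel GH (sigma p) rho) =
  (p%:C ^+ 2 + (1 - p)%:C ^+ 2) * S
  + p%:C * (1 - p)%:C * (\tr rho ^+ 2 - S + (\tr (rho *m rho) - S)).
Proof.
move=> /andP[p0 p1] /=.
have q0 : 0 <= 1 - p by rewrite subr_ge0.
rewrite !mxtrace_sqr_F3 mxtrace_F3 !sum_F3 !conv_channel_GHE !sum_F3 !F3E.
(* With [p] and [1 - p] written as squares of the amplitudes, the claim is a polynomial identity. *)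
rewrite !sigmaE !psi_ampE rmorph0 (sqrtr_complex _ _ p0) (sqrtr_complex _ _ q0).
ring.
Qed.

Lemma conv_channel_purity_le (R : realType) (p : R) (rho : 'M[R[i]]_3) :
  0 <= p <= 1 -> is_density rho ->
  \tr (conv_channel GH (sigma p) rho *m conv_channel GH (sigma p) rho) <=
  (p ^+ 2 + (1 - p) ^+ 2)%:C.
Proof.
move=> p01 dens; rewrite conv_channel_purityE//.
have := density_purity_le1 _ _ _ dens.
have [r rE] := density_diag _ _ _ dens.
(* The spectrum serves to present [\tr (rho *m rho)] as a real number, so that the inequality moves
   from [R[i]] to [R]. *)
have [/hermitian_spectrum[d [_ _ -> _ _]] _ tr] := dens.
have {tr} : \tr rho = 1 by []. rewrite mxtrace_F3 => tr.
have S1 : r 0 + r 1 + r 2%:R = 1.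
  by move: tr; rewrite sum_F3 !(rE _).2 -!rmorphD => -[].
move: (\sum_i d i ^+ 2) => P; rewrite tr sum_F3 !(rE _).2 -[1]/(1%:C).
rewrite -!(rmorphXn, rmorphM, rmorphD, rmorphB) /= !lecR.
have := (rE 0).1; have := (rE 1).1; have := (rE 2%:R).1.
move: p01 S1 => /andP[].
move: (r _) (r _) (r _) => x y z p0 p1 s1 x0 y0 z0 P1.
have q0 : 0 <= p * (1 - p) by rewrite mulr_ge0 ?subr_ge0.
have : p * (1 - p) * P <= p * (1 - p) * 1 by rewrite ler_wpM2l.
have S0 : z ^+ 2 + y ^+ 2 + x ^+ 2 <= 1 by nra.
(* With [c = p (1 - p)] and [S] the sum of squares, this is the slack [(1 - 4 c) (1 - S)]. *)
have : 0 <= (1 - 2 * p) ^+ 2 * (1 - (z ^+ 2 + y ^+ 2 + x ^+ 2)).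
  by rewrite mulr_ge0 ?sqr_ge0 ?subr_ge0.
nra.
Qed.

(** * Weyl operators and dephasing *)

Lemma omega3_norm1 (R : realType) : omega3 R * Num.conj (omega3 R) = 1.
Proof.
apply/eqP; rewrite eq_complex /=.
rewrite mulrN opprK -!expr2 cos2Dsin2 eqxx /=.
by rewrite mulrN [X in _ + X]mulrC addNr.
Qed.

Lemma omega3_cube (R : realType) : omega3 R ^+ 3 = 1.
Proof.
have cisM (a b : R) : (cos a +i* sin a) * (cos b +i* sin b) = cos (a + b) +i* sin (a + b).
  by apply/eqP; rewrite eq_complex /= cosD sinD [cos a * sin b + _]addrC !eqxx.
rewrite 2!exprS expr1 !cisM.
have -> : 2 * pi / 3 + (2 * pi / 3 + 2 * pi / 3) = 0 + pi *+ 2 :> R.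
  by rewrite mulr2n; field.
by rewrite cosD2pi sinD2pi cos0 sin0.
Qed.

Lemma sum_powers_omega3 (R : realType) : 1 + omega3 R + omega3 R ^+ 2 = 0.
Proof.
have ne1 : omega3 R - 1 != 0.
  rewrite subr_eq0 eq_complex negb_and orbC /= gt_eqF// sin_gt0_pi//.
  by have := pi_gt0 R; lra.
apply: (mulfI ne1); rewrite mulr0.
transitivity (omega3 R ^+ 3 - 1); first by ring.
by rewrite omega3_cube subrr.
Qed.

(** An additive character: [a] acts through its representative in {0, 1, 2}, and [omega3 R ^+ 3 = 1]
    absorbs the carries. *)
Definition F3_char (R : realType) (a : 'F_3) : R[i] := omega3 R ^+ a.

Lemma F3_charD (R : realType) (a b : 'F_3) :
  F3_char R (a + b) = F3_char R a * F3_char R b.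
Proof.
rewrite /F3_char -exprD; elim/F3_ind: a; elim/F3_ind: b => //=.
- by rewrite [RHS]omega3_cube.
- by rewrite [RHS]omega3_cube.
- by rewrite [RHS](exprD _ 3 1) omega3_cube mul1r.
Qed.

Lemma F3_char0 (R : realType) : F3_char R 0 = 1.
Proof. by []. Qed.

Lemma F3_charJ (R : realType) (a : 'F_3) : Num.conj (F3_char R a) = F3_char R (- a).
Proof.
have u : F3_char R a * Num.conj (F3_char R a) = 1.
  by rewrite /F3_char rmorphXn -exprMn omega3_norm1 expr1n.
have v : F3_char R a * F3_char R (- a) = 1 by rewrite -F3_charD subrr.
have nz : F3_char R a != 0.
  by apply: contra_eq_neq u => ->; rewrite mul0r eq_sym oner_eq0.
by apply: (mulfI nz); rewrite u v.
Qed.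

Lemma F3_charX (R : realType) (a b : 'F_3) : F3_char R a ^+ b = F3_char R (b * a).
Proof.
elim/F3_ind: b; rewrite ?mul0r ?mul1r//.
by rewrite /= expr2 -F3_charD; congr F3_char; elim/F3_ind: a; apply/eqP.
Qed.

Lemma sum_F3_char (R : realType) (a : 'F_3) :
  \sum_(k : 'F_3) F3_char R (k * a) = if a == 0 then 3 else 0.
Proof.
have s0 := sum_powers_omega3 R.
have e22 : 2%:R * 2%:R = 1 :> 'F_3 by apply/eqP.
rewrite sum_F3 mul0r mul1r; elim/F3_ind: a.
- by rewrite mulr0 F3_char0 eqxx; ring.
- by rewrite mulr1 -[RHS]s0.
- by rewrite e22 addrAC -[RHS]s0.
Qed.

Lemma weylZXE (R : realType) n (i j : 'F_3) :
  (weylZ R ^+ n) i j = F3_char R i ^+ n *+ (i == j).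
Proof.
elim: n j => [|n IH] j; first by rewrite expr0 mxE.
rewrite exprSr mxE (bigD1 i)//= big1 ?addr0 => [|k ki]; last first.
  by rewrite IH eq_sym (negbTE ki) mul0r.
rewrite IH eqxx mulr1n summxE (bigD1 i)//= big1 ?addr0 => [|k ki]; last first.
  by rewrite trmx_delta map_delta_mx mul_delta_mx !mxE eq_sym (negbTE ki) mulr0.
rewrite trmx_delta map_delta_mx mul_delta_mx !mxE eqxx /= exprSr.
by rewrite -/(F3_char R i) eq_sym; case: eqP; rewrite ?mulr1 ?mulr0.
Qed.

Lemma weylXXE (R : realType) n (i j : 'F_3) :
  (weylX R ^+ n) i j = (i == j + n%:R)%:R.
Proof.
elim: n i => [|n IH] i; first by rewrite expr0 mxE addr0.
have XE (k : 'F_3) : weylX R i k = (i == k + 1)%:R.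
  rewrite summxE (bigD1 k)//= big1 ?addr0 => [|l lk]; last first.
    by rewrite trmx_delta map_delta_mx mul_delta_mx !mxE [k == l]eq_sym (negbTE lk) andbF.
  by rewrite trmx_delta map_delta_mx mul_delta_mx !mxE eqxx andbT.
rewrite exprS mxE (bigD1 (j + n%:R))//= big1 ?addr0 => [|k kn]; last first.
  by rewrite IH (negbTE kn) mulr0.
by rewrite IH eqxx mulr1 XE -addrA natr1.
Qed.

(** The scalar phase stays unspecified: having modulus one, it cancels in every conjugation by a
    Weyl operator. *)
Lemma weylE (R : realType) (u : phase_space) : exists2 c : R[i], c * Num.conj c = 1 &
  forall i j : 'F_3, weyl R u i j = c * F3_char R (u.1 * i) *+ (i == j + u.2).
Proof.
rewrite /weyl; set e := - _.
exists (F3_char R e) => [|i j].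
  by rewrite F3_charJ -F3_charD subrr.
rewrite 2!mxE (bigD1 i)//= big1 ?addr0 => [|k ki]; last first.
  by rewrite weylZXE eq_sym (negbTE ki) mul0r.
rewrite weylZXE eqxx mulr1n weylXXE F3_charX natr_Zp mulrA.
by case: eqP; rewrite ?mulr1 ?mulr0.
Qed.

Lemma weyl_conjE (R : realType) (u : phase_space) (A : 'M[R[i]]_3) (i j : 'F_3) :
  (weyl R u *m A *m (weyl R u)^t*) i j =
  F3_char R (u.1 * (i - j)) * A (i - u.2) (j - u.2).
Proof.
have [c c1 E] := weylE R u.
rewrite mxE (bigD1 (j - u.2))//= big1 ?addr0 => [|k kj]; last first.
  rewrite [X in _ * X]mxE [X in _ * _ X]mxE E mulrb ifN ?conjC0 ?mulr0//.
  by apply: contraNneq kj => ->; rewrite addrK.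
rewrite mxE (bigD1 (i - u.2))//= big1 ?addr0 => [|k kj]; last first.
  rewrite E mulrb ifN ?mul0r//.
  by apply: contraNneq kj => ->; rewrite addrK.
rewrite [X in _ * X]mxE [X in _ * _ X]mxE !E !subrK !eqxx !mulr1n.
rewrite rmorphM /= F3_charJ mulrBr F3_charD.
rewrite -[RHS]mul1r -c1. ring.
Qed.

(** * Dephasing along a line *)

Lemma sum_vline (V : nmodType) (u : phase_space) (F : phase_space -> V) : u != 0 ->
  \sum_(v | v \in <[u]>%VS) F v = \sum_(k : 'F_3) F (k *: u).
Proof.
move=> u0.
have inj : injective (fun k : 'F_3 => k *: u).
  move=> k l /eqP; rewrite -subr_eq0 -scalerBl scaler_eq0 (negbTE u0) orbF subr_eq0.
  by move/eqP.
rewrite -(big_imset F (in2W inj)) /=; apply: eq_bigl => v.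
apply/vlineP/imsetP => [[k ->]|[k _ ->]]; by exists k.
Qed.

Lemma dephasing_lineE (R : realType) (u : phase_space) (A : 'M[R[i]]_3) (i j : 'F_3) :
  u != 0 ->
  dephasing <[u]>%VS A i j = 3%:R^-1 *
    \sum_(k : 'F_3) F3_char R (k * (u.1 * (i - j))) * A (i - k * u.2) (j - k * u.2).
Proof.
move=> u0; rewrite mxE sum_vline// summxE; congr (_ * _); apply: eq_bigr => k _.
by rewrite weyl_conjE mulrA.
Qed.

Lemma maximal_isotropic_line (M : {vspace phase_space}) :
  maximal_isotropic M -> exists2 u, u != 0 & M = <[u]>%VS.
Proof.
move=> [_ dM]; have M0 : vpick M != 0 by rewrite vpick0 -dimv_eq0 dM.
exists (vpick M) => //; apply/esym/eqP.
by rewrite eqEdim -memvE memv_pick dim_vline M0 dM.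
Qed.

Lemma maximal_isotropic_Z : maximal_isotropic <[(1%R, 0%R) : phase_space]>%VS.
Proof.
split; last by rewrite dim_vline.
move=> _ _ /vlineP[k ->] /vlineP[l ->]; rewrite /symp_form /=.
by rewrite !scaler0 !mulr0 subr0.
Qed.

Lemma sum_sigma_diag (R : realType) (p : R) : 0 <= p <= 1 ->
  \sum_(k : 'F_3) sigma p k k = 1.
Proof.
move=> /andP[p0 p1]; rewrite sum_F3 !sigmaE !psi_ampE -!sqrtr_complex ?subr_ge0//.
by rewrite rmorph0 mulr0 addr0 -rmorphD /= addrC subrK.
Qed.

Lemma dephasing_density (R : realType) (u : phase_space) (p : R) :
  0 <= p <= 1 -> u != 0 -> is_density (dephasing <[u]>%VS (sigma p)).
Proof.
move=> p01 u0.
have conj_amp k : Num.conj ((psi_amp R p k)%:C) = (psi_amp R p k)%:C by exact: conjc_real.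
split.
- apply/hermsymmxP => i j; rewrite !dephasing_lineE// rmorphM rmorph_sum /=.
  congr (_ * _); first by rewrite fmorphV rmorph_nat.
  apply: eq_bigr => k _; rewrite !sigmaE !rmorphM /= F3_charJ !conj_amp.
  rewrite [_%:C * _%:C]mulrC; congr (F3_char _ _ * _).
  by rewrite -mulrN -mulrN opprB.
- move=> v; rewrite /dephasing -scalemxAr -scalemxAl mxE mulr_ge0 ?invr_ge0 ?ler0n//.
  rewrite mulmx_sumr mulmx_suml summxE; apply: sumr_ge0 => w _.
  have -> : v^t* *m (weyl R w *m sigma p *m (weyl R w)^t*) *m v =
    (v^t* *m weyl R w *m psi p) *m (v^t* *m weyl R w *m psi p)^t*.
    by rewrite !trmx_mul !map_mxM /= trmxCK !mulmxA.
  rewrite mxE big_ord1 [X in _ * X]mxE [X in _ * _ X]mxE; exact: mul_conjC_ge0.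
- transitivity (\sum_(i : 'F_3) dephasing <[u]>%VS (sigma p) i i) => //.
  under eq_bigr do rewrite dephasing_lineE//.
  rewrite -mulr_sumr exchange_big /= (eq_bigr (fun=> 1)) => [|k _].
    have e3 : 1 + 1 + 1 = 3%:R :> R[i] by ring.
    by rewrite sum_F3 e3 mulVf// pnatr_eq0.
  under eq_bigr do rewrite subrr !mulr0 F3_char0 mul1r.
  rewrite -(sum_sigma_diag _ _ p01).
  by rewrite [RHS](reindex_inj (addIr (- (k * u.2)))).
Qed.

(** A line with [u.2 != 0] moves every label through all positions, so the diagonal becomes uniform;
    the six off-diagonal products each equal [p (1 - p) / 9]. *)
Lemma dephasing_purity_le (R : realType) (u : phase_space) (p : R) :
  0 <= p <= 1 -> (u.2 : 'F_3) != 0 ->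
  \tr (dephasing <[u]>%VS (sigma p) *m dephasing <[u]>%VS (sigma p)) <=
  (p ^+ 2 + (1 - p) ^+ 2)%:C.
Proof.
move=> p01 u2; set D := dephasing _ _; have /andP[p0 p1] := p01.
have q0 : 0 <= 1 - p by rewrite subr_ge0.
have u0 : u != 0 by apply: contraNneq u2 => ->.
have Dii i : D i i = 3%:R^-1.
  rewrite dephasing_lineE// -[RHS]mulr1; congr (_ * _).
  under eq_bigr do rewrite subrr !mulr0 F3_char0 mul1r.
  rewrite -(sum_sigma_diag _ _ p01) [RHS](reindex_inj (h := fun k : 'F_3 => i - k * u.2))//.
  by move=> k l /addrI/oppr_inj/(mulIf u2).
have Dij i j : i != j -> D i j * D j i = 3%:R^-1 * 3%:R^-1 * (p%:C * (1 - p)%:C).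
  move=> ij; rewrite !dephasing_lineE//.
  (* sigma has only one off-diagonal pair, so a single k contributes to each factor,
     the same for both, and the phases cancel. *)
  have ch k : F3_char R (k * (u.1 * (i - j))) * F3_char R (k * (u.1 * (j - i))) = 1.
    by rewrite -F3_charD -!mulrDr addrC subrKA subrr !mulr0.
  have := (ch 0, ch 1, ch 2%:R); rewrite !sum_F3.
  move: (F3_char R (0 * _)) (F3_char R (1 * _)) (F3_char R (2%:R * _)).
  move: (F3_char R (0 * _)) (F3_char R (1 * _)) (F3_char R (2%:R * _)).
  move=> g0 g1 g2 f0 f1 f2 [[fg0 fg1] fg2]; rewrite mul0r mul1r.
  have e22 : 2%:R * 2%:R = 1 :> 'F_3 by apply/eqP.
  rewrite !sigmaE (sqrtr_complex _ _ p0) (sqrtr_complex _ _ q0).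
  clear Dii; move: (u.2) u2 ij; clear -fg0 fg1 fg2 e22.
  move=> y; elim/F3_ind: y; elim/F3_ind: i; elim/F3_ind: j => //= _ _;
  rewrite ?mulr1 ?e22 !F3E !psi_ampE rmorph0;
  by first [ rewrite -[RHS]mulr1 -fg0; ring | rewrite -[RHS]mulr1 -fg1; ring
                | rewrite -[RHS]mulr1 -fg2; ring ].
have e3 : 3%:R^-1 = (3%:R^-1)%:C :> R[i] by rewrite fmorphV rmorph_nat.
rewrite mxtrace_sqr_F3 !sum_F3 !Dii !Dij// e3 -!(rmorphM, rmorphD) lecR.
(* The slack is two thirds of this square. *)
have := sqr_ge0 (1 - 2 * p); lra.
Qed.

(** The operators on this line are diagonal phases, and orthogonality of characters removes every
    off-diagonal entry. *)
Lemma dephasing_ZE (R : realType) (u : phase_space) (p : R) :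
  0 <= p <= 1 -> u != 0 -> u.2 = 0 ->
  dephasing <[u]>%VS (sigma p) =
  diag_mx (map_mx (fun x => x%:C) (\row_(k < 3) psi_amp R p k ^+ 2)).
Proof.
move=> p01 u0 u2.
have u1 : (u.1 : 'F_3) != 0.
  by apply: contraNneq u0 => u1; apply/eqP; case: u u1 u2 => x y /= -> ->.
apply/matrixP => i j; rewrite dephasing_lineE// u2.
under eq_bigr do rewrite mulr0 !subr0.
rewrite -mulr_suml sum_F3_char mulf_eq0 (negbTE u1) /= subr_eq0 sigmaE !mxE -rmorphM.
case: eqP => [->|_]; last by rewrite mul0r mulr0.
by rewrite mulKf ?pnatr_eq0// mulr1n expr2.
Qed.

Lemma entropy_psi_amp (R : realType) (p : R) : 0 <= p <= 1 ->
  - (\sum_(k : 'F_3) psi_amp R p k ^+ 2 * log2 (psi_amp R p k ^+ 2)) = h2 p.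
Proof.
move=> /andP[p0 p1]; rewrite sum_F3 !psi_ampE !sqr_sqrtr ?subr_ge0// expr0n mul0r addr0.
by rewrite opprD.
Qed.

Lemma dephasing_Z_entropy (R : realType) (u : phase_space) (p : R) :
  0 <= p <= 1 -> u != 0 -> u.2 = 0 ->
  vn_entropy (dephasing <[u]>%VS (sigma p)) = h2 p.
Proof.
move=> p01 u0 u2; rewrite dephasing_ZE// vn_entropy_diag -(entropy_psi_amp _ _ p01).
by under eq_bigr do rewrite mxE.
Qed.

Lemma dephasing_entropy_ge (R : realType) (M : {vspace phase_space}) (p : R) :
  0 <= p <= 1 -> maximal_isotropic M ->
  h2 p <= vn_entropy (dephasing M (sigma p)).
Proof.
move=> p01 /maximal_isotropic_line[u u0 ->].
have [u2|u2] := eqVneq (u.2 : 'F_3) 0; first by rewrite dephasing_Z_entropy.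
by apply: vn_entropy_ge_h2; [|exact: dephasing_density|exact: dephasing_purity_le].
Qed.

(** * Basis states and the maximally mixed state *)

Lemma ket_density (R : realType) (l : 'F_3) : is_density (ket R l *m (ket R l)^t*).
Proof.
split.
- by apply/hermsymmxP => i j; rewrite trmx_delta map_delta_mx mul_delta_mx !mxE rmorph_nat andbC.
- move=> v.
  have -> : v^t* *m (ket R l *m (ket R l)^t*) *m v = (v^t* *m ket R l) *m (v^t* *m ket R l)^t*.
    by rewrite trmx_mul map_mxM /= trmxCK !mulmxA.
  rewrite mxE big_ord1 [X in _ * X]mxE [X in _ * _ X]mxE; exact: mul_conjC_ge0.
- by rewrite mxtrace_mulC trmx_delta map_delta_mx mul_delta_mx /mxtrace big_ord1 mxE.
Qed.

(** Only [k = l - i] contributes to row [i], and it also fits column [j] only when [i = j]; the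
    weight then sits at [i - k = i + i - l]. *)
Lemma conv_channel_ketE (R : realType) (p : R) (l : 'F_3) :
  conv_channel GH (sigma p) (ket R l *m (ket R l)^t*) =
  diag_mx (map_mx (fun x => x%:C) (\row_(k < 3) psi_amp R p ((k : 'F_3) + k - l) ^+ 2)).
Proof.
have ketE (i j : 'F_3) : (ket R l *m (ket R l)^t*) i j = ((i == l) && (j == l))%:R.
  by rewrite trmx_delta map_delta_mx mul_delta_mx mxE.
apply/matrixP => i j; rewrite conv_channel_GHE (bigD1 (l - i))//= big1 ?addr0 => [|k kl].
  rewrite ketE addrCA subrr addr0 eqxx /= sigmaE !mxE.
  have [->|ij] := eqVneq i j.
    by rewrite addrCA subrr addr0 eqxx mul1r mulr1n opprB addrA rmorphXn expr2.
  suff /negbTE -> : j + (l - i) != l by rewrite mul0r.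
  by rewrite addrCA -subr_eq0 addrAC subrr add0r subr_eq0 eq_sym.
rewrite ketE; suff /negbTE -> : i + k != l by rewrite mul0r.
by apply: contraNneq kl => <-; rewrite addrAC subrr add0r.
Qed.

Lemma conv_channel_ket_entropy (R : realType) (p : R) (l : 'F_3) : 0 <= p <= 1 ->
  vn_entropy (conv_channel GH (sigma p) (ket R l *m (ket R l)^t*)) = h2 p.
Proof.
move=> p01; rewrite conv_channel_ketE vn_entropy_diag -(entropy_psi_amp _ _ p01).
congr (- _); under eq_bigr do rewrite mxE.
(* Doubling is invertible mod 3, so the output weights are a permutation of those of [sigma p]. *)
rewrite [RHS](reindex_inj (h := fun k : 'F_3 => k + k - l))//.
by move=> i k /addIr; elim/F3_ind: i; elim/F3_ind: k.
Qed.

(** On the diagonal, [k -> i - k] runs over all labels and leaves the trace of [sigma p]. *)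
Lemma conv_channel_mixed (R : realType) (p : R) : 0 <= p <= 1 ->
  conv_channel GH (sigma p) (3%:R^-1)%:M = (3%:R^-1)%:M.
Proof.
move=> p01; apply/matrixP => i j; rewrite conv_channel_GHE !mxE.
have [->|ij] := eqVneq i j.
  under eq_bigr do rewrite mxE eqxx mulr1n.
  rewrite -mulr_sumr -[RHS]mulr1 -(sum_sigma_diag _ _ p01); congr (_ * _).
  rewrite [RHS](reindex_inj (h := fun k : 'F_3 => j - k))//.
  by move=> k l /addrI/oppr_inj.
by rewrite big1// => k _; rewrite mxE (inj_eq (addIr k)) (negbTE ij) mul0r.
Qed.

Lemma vn_entropy_mixed (R : realType) :
  vn_entropy ((3%:R^-1)%:M : 'M[R[i]]_3) = log2 3.
Proof.
have -> : (3%:R^-1)%:M = diag_mx (map_mx (fun x => x%:C) (const_mx 3%:R^-1)) :> 'M[R[i]]_3.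
  by rewrite map_const_mx diag_const_mx; congr (_%:M); rewrite fmorphV rmorph_nat.
rewrite vn_entropy_diag; under eq_bigr do rewrite mxE.
rewrite sumr_const card_ord /log2 lnV ?posrE ?ltr0n//.
by rewrite -mulr_natl; field; rewrite gt_eqF// ln_gt0// ltr1n.
Qed.

(** * The Holevo bound and its attainment *)

Lemma density_mix (R : realType) n k (q : 'I_k -> R) (rho : 'I_k -> 'M[R[i]]_n) :
  is_ensemble q rho -> is_density (\sum_i (q i)%:C *: rho i).
Proof.
move=> [q0 q1 dens]; split.
- apply/hermsymmxP => i j; rewrite !summxE rmorph_sum; apply: eq_bigr => l _.
  rewrite !mxE rmorphM /=; have [/hermsymmxP <- _ _] := dens l.
  by congr (_ * _); apply/esym/conjc_real.
- move=> v; rewrite mulmx_sumr mulmx_suml summxE; apply: sumr_ge0 => l _.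
  rewrite -scalemxAr -scalemxAl mxE mulr_ge0 ?ler0c//.
  by have [_ pos _] := dens l.
- rewrite raddf_sum /= (eq_bigr (fun i => (q i)%:C)) => [|l _].
    by rewrite -rmorph_sum /= q1.
  by rewrite mxtraceZ; have [_ _ ->] := dens l; rewrite mulr1.
Qed.

(** The two terms are bounded separately; nothing is lost, since the uniform ensemble of basis
    states is extremal for both. *)
Lemma holevo_quantity_le (R : realType) (p : R) k (q : 'I_k -> R) (rho : 'I_k -> 'M[R[i]]_3) :
  0 <= p <= 1 -> is_ensemble q rho ->
  holevo_quantity (conv_channel GH (sigma p)) q rho <= log2 3 - h2 p.
Proof.
move=> p01 ens; apply: lerB.
  by apply/vn_entropy_le_log3/conv_channel_density/density_mix.
have [q0 q1 dens] := ens.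
rewrite -[leLHS]mul1r -q1 mulr_suml; apply: ler_sum => i _; rewrite ler_wpM2l//.
apply: vn_entropy_ge_h2 => //; first exact: conv_channel_density.
exact: conv_channel_purity_le.
Qed.

Lemma holevo_quantity_attained (R : realType) (p : R) : 0 <= p <= 1 ->
  holevo_quantities (conv_channel GH (sigma p)) (log2 3 - h2 p).
Proof.
move=> p01; exists 3, (fun=> 3%:R^-1), (fun l => ket R l *m (ket R l)^t*); split.
  split=> [_||l]; first by rewrite invr_ge0 ler0n.
    by rewrite sumr_const card_ord -[LHS]mulr_natr mulVf// pnatr_eq0.
  exact: ket_density.
rewrite /holevo_quantity; congr (_ - _).
  rewrite -scaler_sumr.
  have -> : \sum_l ket R l *m (ket R l)^t* = 1%:M.
    apply/matrixP => i j; rewrite summxE (bigD1 i)//= big1 => [|l li].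
      by rewrite trmx_delta map_delta_mx mul_delta_mx !mxE eqxx addr0 eq_sym.
    by rewrite trmx_delta map_delta_mx mul_delta_mx !mxE eq_sym (negbTE li).
  by rewrite scalemx1 fmorphV rmorph_nat conv_channel_mixed// vn_entropy_mixed.
under eq_bigr do rewrite conv_channel_ket_entropy//.
by rewrite sumr_const card_ord -[RHS]mulr_natr mulrC mulrA mulfV ?mul1r// pnatr_eq0.
Qed.

(** An attained bound makes the set nonempty and bounded, which excludes the default value of
    [sup]. *)
Lemma is_max_sup (R : realType) (A : set R) (x : R) : is_max A x -> sup A = x.
Proof.
move=> [Ax ubx]; apply/le_anti/andP; split; first by apply: ge_sup => //; exists x.
by apply: ub_le_sup => //; exists x.
Qed.

Lemma is_min_inf (R : realType) (A : set R) (x : R) : is_min A x -> inf A = x.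
Proof.
move=> [Ax lbx]; apply/le_anti/andP; split; last by apply: lb_le_inf => //; exists x.
by apply: ge_inf => //; exists x.
Qed.

Theorem theorem15 (R : realType) (p : R) (hp : 0 <= p <= 1) :
  [/\ is_max (holevo_quantities (conv_channel GH (sigma p)))
             (holevo_information (conv_channel GH (sigma p))),
      is_min (dephased_entropies (sigma p)) (min_dephased_entropy (sigma p)),
      holevo_information (conv_channel GH (sigma p)) = log2 3 - h2 p
    & log2 3 - h2 p = log2 3 - min_dephased_entropy (sigma p)].
Proof.
have mx : is_max (holevo_quantities (conv_channel GH (sigma p))) (log2 3 - h2 p).
  split; first exact: holevo_quantity_attained.
  by move=> _ [k [q [rho [ens ->]]]]; exact: holevo_quantity_le.
have mn : is_min (dephased_entropies (sigma p)) (h2 p).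
  split.
    exists <[(1%R, 0%R) : phase_space]>%VS; first exact: maximal_isotropic_Z.
    exact: dephasing_Z_entropy.
  by move=> _ [M isoM <-]; exact: dephasing_entropy_ge.
by rewrite /holevo_information /min_dephased_entropy (is_max_sup _ _ _ mx) (is_min_inf _ _ _ mn).
Qed.
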